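(* Let $G$ and $H$ be graphs and let $k,\ell$ be positive integers. Then $$\left\lceil \frac{\Delta(G)\Delta(H)+\Delta(G)+\Delta(H)}{2}\right\rceil\leq {\rm la}_{\max\{k,\ell\}}(G\boxtimes H)\leq {\rm la}_{k}(G)+{\rm la}_{\ell}(H)+2\,{\rm la}_{k}(G)\,{\rm la}_{\ell}(H).$$ Moreover, the bounds are sharp.
   Context: All graphs are finite, simple and undirected; $\Delta(G)$ denotes the maximum degree. A linear $k$-forest is a forest each of whose components is a path of length (number of edges) at most $k$. The linear $k$-arboricity ${\rm la}_k(G)$ of a graph $G$ is the least number of linear $k$-forests (subgraphs of $G$) whose edge sets partition $E(G)$. The strong product $G\boxtimes H$ has vertex set $V(G)\times V(H)$, with $(u,v)$ adjacent to $(u',v')$ iff ($uu'\in E(G)$ and $v=v'$), or ($u=u'$ and $vv'\in E(H)$), or ($uu'\in E(G)$ and $vv'\in E(H)$). *)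

(* Defs.v *)
From mathcomp Require Import all_boot.

Set Implicit Arguments.
Unset Strict Implicit.
Unset Printing Implicit Defensive.

Record sgraph := SGraph {
  svertex :> finType;
  adj : rel svertex;
  adj_sym : symmetric adj;
  adj_irr : irreflexive adj }.

Definition edges (G : sgraph) : {set {set G}} :=
  [set [set p.1; p.2] | p : G * G & adj p.1 p.2].

Definition max_degree (G : sgraph) : nat := \max_(x : G) #|[set y | adj x y]|.

Section StrongProduct.
Variables G H : sgraph.

Definition strong_adj : rel (G * H) := fun p q =>
  [|| adj p.1 q.1 && (p.2 == q.2),
      (p.1 == q.1) && adj p.2 q.2
    | adj p.1 q.1 && adj p.2 q.2].

Fact strong_adj_sym : symmetric strong_adj.
Proof.
by move=> p q; rewrite /strong_adj ![adj q.1 _]adj_sym ![adj q.2 _]adj_sym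
  [q.1 == _]eq_sym [q.2 == _]eq_sym.
Qed.

Fact strong_adj_irr : irreflexive strong_adj.
Proof. by move=> p; rewrite /strong_adj !adj_irr andbF. Qed.

Definition strong_product : sgraph := SGraph strong_adj_sym strong_adj_irr.
End StrongProduct.

Section LinearForest.
Variable T : finType.
Implicit Type e : rel T.

(* A cycle is a duplicate-free cyclic sequence of at least three vertices; *)
(* it has at most #|T| of them, so bounding n loses nothing.              *)
Definition forest e : bool :=
  [forall n : 'I_#|T|.+1, forall c : n.-tuple T,
     cycle e c && uniq c ==> (n < 3)].

Definition component e (x : T) : {set T} := [set y | connect e x y].

(* The subgraph induced on C is a path with n edges (n + 1 vertices). *)
Definition is_path e (C : {set T}) (n : nat) : bool :=
  [exists f : {ffun 'I_n.+1 -> T},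
    [&& injectiveb f, f @: 'I_n.+1 == C
      & [forall i : 'I_n.+1, forall j : 'I_n.+1,
          e (f i) (f j) == ((i.+1 == j :> nat) || (j.+1 == i :> nat))]]].

Definition linear_forest (k : nat) e : bool :=
  forest e &&
  [forall x, exists n : 'I_k.+1, is_path e (component e x) n].
End LinearForest.

Section LinearArboricity.
Variables (k : nat) (G : sgraph).

(* The spanning subgraph with edge set F. The vertices that F does not cover *)
(* are isolated, i.e. components that are paths of length 0.                 *)
Definition edge_rel (F : {set {set G}}) : rel G := fun x y => [set x; y] \in F.

Definition linear_decomposition (P : {set {set {set G}}}) : bool :=
  partition P (edges G) && [forall F in P, linear_forest k (edge_rel F)].

Definition single_edges : {set {set {set G}}} := [set [set a] | a in edges G].

(* For 0 < k the partition of the edges into single edges is a linear      *)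
(* decomposition, so that the minimum is attained (linear_arboricityP). For *)
(* k = 0 the value is irrelevant.                                          *)
Definition linear_arboricity : nat :=
  #|[arg min_(P < single_edges | linear_decomposition P) #|P|]|.

Lemma single_edgesP : 0 < k -> linear_decomposition single_edges.
Proof.
move=> k_gt0; apply/andP; split.
  apply/and3P; split.
  - apply/eqP/setP=> a; apply/bigcupP/idP => [[_ /imsetP[b bE ->]]|aE].
      by rewrite inE => /eqP->.
    by exists [set a]; rewrite ?set11 //; apply: imset_f.
  - apply/trivIsetP=> _ _ /imsetP[a _ ->] /imsetP[b _ ->] neq.
    rewrite disjoints1 inE; apply: contraNneq neq => ->; exact: eqxx.
  - by apply/imsetP=> -[a _ /setP/(_ a)]; rewrite !inE eqxx.
apply/'forall_implyP=> _ /imsetP[_ /imsetP[[u v] /= uv ->] ->].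
rewrite inE /= in uv; set e := edge_rel _.
have neq_uv : u != v by apply: contraTneq uv => ->; rewrite adj_irr.
have eE x y : e x y = (x == u) && (y == v) || (x == v) && (y == u).
  rewrite /e /edge_rel inE; apply/eqP/orP=> [/setP eq|]; last first.
    by case=> /andP[/eqP-> /eqP->] //; rewrite setUC.
  have := eq y; have := eq x; have := eq v; have := eq u.
  rewrite !inE !eqxx !orbT /= => eu ev /esym/orP[]/eqP ? /esym/orP[]/eqP ?;
    subst x y; rewrite ?eqxx; try (by left); try (by right).
  - by rewrite eq_sym (negPf neq_uv) in ev.
  - by rewrite (negPf neq_uv) in eu.
apply/andP; split.
  apply/forallP=> -[n ltn]; apply/forallP=> -[c /= /eqP sz_c]; apply/implyP.
  rewrite ltnNge -sz_c; case: c {sz_c} => [|a [|b [|d c]]] //= /andP[].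
  rewrite !eE !inE => /and3P[ab bd _] /and3P[/norP[_ /norP[ad _]] _ _].
  move: bd ad; case/orP: ab => /andP[/eqP-> /eqP->]; rewrite !eqxx.
    by rewrite eq_sym (negPf neq_uv) /= => /eqP->; rewrite eqxx.
  by rewrite (negPf neq_uv) /= orbF => /eqP->; rewrite eqxx.
have step x y : e x y -> (x \in [set u; v]) && (y \in [set u; v]).
  by rewrite eE !inE => /orP[]/andP[-> ->]; rewrite ?orbT.
have walk p x : x \in [set u; v] -> path e x p -> last x p \in [set u; v].
  elim: p x => //= y p IHp x _ /andP[/step/andP[_ yuv]]; exact: IHp.
apply/forallP=> x; have [xuv|xuv] := boolP (x \in [set u; v]).
  have k1 : 1 < k.+1 by [].
  apply/existsP; exists (Ordinal k1); apply/existsP.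
  exists [ffun i : 'I_2 => if i == 0 :> nat then u else v].
  apply/and3P; split.
  - apply/injectiveP=> -[[|[|?]] ?] -[[|[|?]] ?] //; rewrite !ffunE /= => eq;
      apply: val_inj => //=; by rewrite eq eqxx in neq_uv.
  - apply/eqP/setP=> y; rewrite [RHS]inE; apply/imsetP/idP => [[i _ ->]|].
      have inuv : connect e u v by apply: connect1; rewrite eE !eqxx.
      have invu : connect e v u by apply: connect1; rewrite eE !eqxx orbT.
      by rewrite ffunE; move: xuv; rewrite !inE => /orP[]/eqP->; case: ifP.
    case/connectP=> p pth ->; have := walk p x xuv pth.
    rewrite !inE => /orP[]/eqP->; [exists ord0 | exists ord_max] => //;
      by rewrite ffunE.
  - apply/forallP=> -[[|[|?]] ?] //; apply/forallP=> -[[|[|?]] ?] //;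
    by rewrite !ffunE /= eE !eqxx ?(negPf neq_uv) ?[v == u]eq_sym ?(negPf neq_uv).
apply/existsP; exists ord0; apply/existsP; exists [ffun=> x].
apply/and3P; split.
- by apply/injectiveP=> i j _; rewrite (ord1 i) (ord1 j).
- apply/eqP/setP=> y; rewrite [RHS]inE; apply/imsetP/idP => [[i _ ->]|].
    by rewrite ffunE.
  case/connectP=> -[_ ->|z p /= /andP[/step]]; last by rewrite (negPf xuv).
  by exists ord0; rewrite ?ffunE.
- apply/forallP=> i; apply/forallP=> j; rewrite !ffunE (ord1 i) (ord1 j) /=.
  by apply/eqP/negbTE; apply: contra xuv => /step/andP[].
Qed.

Lemma linear_arboricityP : 0 < k ->
  (exists2 P, linear_decomposition P & #|P| = linear_arboricity) /\
  (forall P, linear_decomposition P -> linear_arboricity <= #|P|).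
Proof.
move=> k_gt0; rewrite /linear_arboricity.
case: arg_minnP => [|P decP minP]; first exact: single_edgesP.
by split=> //; exists P.
Qed.
End LinearArboricity.

(* Main.v *)
(** A linear k-forest is the symmetric closure of a partial injection that has a
    rank function with values at most k: its maximal directed paths are the
    components. Such orientations are stable under taking subrelations, so the
    linear k-arboricity is the least size of a cover of the edges by them.
    If [d1] and [d2] orient forests of [G] and [H], then the four relations
    [d1 x =], [= x d2], [d1 x d2] and [d1 x d2^-1] orient forests of the strong
    product; this gives the upper bound. The lower bound holds because an
    orientation contributes at most two neighbours to each vertex. The bounds
    coincide as soon as the maximum degrees of [G] and [H] are twice their
    linear arboricities, as for the path with two edges. *)

Require Import Defs.
From mathcomp Require Import all_boot.

Set Implicit Arguments.
Unset Strict Implicit.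
Unset Printing Implicit Defensive.

Lemma eq_set2 (T : finType) (x y u v : T) :
  ([set x; y] == [set u; v]) = (x == u) && (y == v) || (x == v) && (y == u).
Proof.
apply/eqP/orP=> [eq_xyuv|[]/andP[/eqP-> /eqP->] //]; last exact: setUC.
have: u \in [set x; y] by rewrite eq_xyuv set21.
have: v \in [set x; y] by rewrite eq_xyuv set22.
have: x \in [set u; v] by rewrite -eq_xyuv set21.
have: y \in [set u; v] by rewrite -eq_xyuv set22.
rewrite !inE => /orP[]/eqP-> /orP[]/eqP->; rewrite ?eqxx ?andbT ?orbb /=; auto.
- by move=> /eqP->; rewrite eqxx; left.
- by move=> _ /eqP->; rewrite eqxx; left.
Qed.

Lemma leq_card_preim_partition (T rT : finType) (f : T -> rT) (D : {set T}) :
  #|preim_partition f D| <= #|f @: D|.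
Proof.
have -> : preim_partition f D = [set [set y in D | c == f y] | c in f @: D].
  by rewrite -imset_comp.
exact: leq_imset_card.
Qed.

Lemma refine_cover_partition (T I : finType) (E : {set T}) (F : I -> {set T}) :
  E \subset \bigcup_i F i ->
  exists P : {set {set T}},
    [/\ partition P E, #|P| <= #|I|
      & forall B, B \in P -> exists i, B \subset F i].
Proof.
move=> /subsetP EF; pose c x := [pick i | x \in F i].
have cP x : x \in E -> exists2 i, c x = Some i & x \in F i.
  rewrite /c; case: pickP => [i xFi _|noF /EF /bigcupP[i _]]; first by exists i.
  by rewrite noF.
exists (preim_partition c E); split=> [||B /imsetP[x /cP[i cx _] ->]].
- exact: preim_partitionP.
- apply: leq_trans (leq_card_preim_partition c E) _.
  rewrite -cardsT; apply: leq_trans (leq_imset_card Some _).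
  apply/subset_leq_card/subsetP=> _ /imsetP[x /cP[i -> _] ->].
  exact: imset_f.
exists i; apply/subsetP=> y; rewrite inE cx => /andP[/cP[j -> yFj]].
by move=> /eqP[->].
Qed.

Lemma next_eq_prev_size (T : finType) (c : seq T) (x : T) :
  uniq c -> x \in c -> next c x = prev c x -> size c <= 2.
Proof.
move=> Uc xc next_prev_x; have next2_x : next c (next c x) = x.
  by rewrite next_prev_x next_prev.
rewrite -(order_cycle (cycle_next Uc) Uc xc).
apply: (@order_le_cycle _ _ [:: x; next c x]); last exact: mem_head.
by rewrite /= next2_x !eqxx.
Qed.

Section Relations.
Variable T : Type.
Implicit Type d : rel T.

Definition functional d : Prop :=
  forall x y z, d x y -> d x z -> y = z.

Definition partial_injection d : Prop :=
  functional d /\ functional [rel x y | d y x].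

Definition sym_closure d : rel T := fun x y => d x y || d y x.

Definition rank_function d (r : T -> nat) : Prop :=
  forall x y, d x y -> r y = (r x).+1.

Definition linear_orientation (k : nat) d : Prop :=
  partial_injection d /\ exists2 r, rank_function d r & forall x, r x <= k.

Lemma sym_closure_sym d : symmetric (sym_closure d).
Proof. by move=> x y; rewrite /sym_closure orbC. Qed.

Lemma sub_functional d d' : subrel d' d -> functional d -> functional d'.
Proof. by move=> sub df x y z /sub xy /sub; apply: df xy. Qed.

Lemma sub_partial_injection d d' :
  subrel d' d -> partial_injection d -> partial_injection d'.
Proof.
by move=> sub [df di]; split; [apply: sub_functional df
  | apply: sub_functional di => x y; apply: sub].
Qed.

Lemma partial_injection_converse d :
  partial_injection d -> partial_injection [rel x y | d y x].
Proof. by case. Qed.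

Lemma sub_linear_orientation k d d' :
  subrel d' d -> linear_orientation k d -> linear_orientation k d'.
Proof.
move=> sub [d_inj [r dr rk]]; split; first exact: sub_partial_injection d_inj.
by exists r => // x y /sub /dr.
Qed.

Lemma linear_orientation_leq k l d :
  k <= l -> linear_orientation k d -> linear_orientation l d.
Proof.
move=> kl [d_inj [r dr rk]]; split=> //.
by exists r => // x; apply: leq_trans kl.
Qed.

Lemma functional_path_inj d x p q :
  functional d -> path d x p -> path d x q -> size p = size q -> p = q.
Proof.
move=> df; elim: p x q => [|y p IHp] x [|z q] //=.
move=> /andP[xy yp] /andP[xz zq] [sz].
by rewrite -(df _ _ _ xy xz) in zq *; rewrite (IHp y q).
Qed.

Lemma rank_path d r x p : rank_function d r -> path d x p ->
  map r (x :: p) = iota (r x) (size p).+1.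
Proof.
move=> dr; elim: p x => //= y p IHp x /andP[/dr xy /IHp]; rewrite /= xy.
by move=> [->].
Qed.

Lemma rank_last d r x p : rank_function d r -> path d x p ->
  r (last x p) = r x + size p.
Proof.
move=> dr; elim: p x => [|y p IHp] x /=; first by rewrite addn0.
by case/andP=> /dr xy /IHp->; rewrite xy addSnnS.
Qed.

End Relations.

Lemma partial_injection_eq_op (T : eqType) : partial_injection (@eq_op T).
Proof. by split=> x y z /= /eqP-> /eqP. Qed.

Section Product.
Variables T1 T2 : Type.

Definition rel_prod (d1 : rel T1) (d2 : rel T2) : rel (T1 * T2) :=
  fun p q => d1 p.1 q.1 && d2 p.2 q.2.

Lemma functional_prod d1 d2 :
  functional d1 -> functional d2 -> functional (rel_prod d1 d2).
Proof.
move=> d1f d2f [x1 x2] [y1 y2] [z1 z2] /andP[/= xy1 xy2] /andP[/= xz1 xz2].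
by rewrite (d1f _ _ _ xy1 xz1) (d2f _ _ _ xy2 xz2).
Qed.

Lemma partial_injection_prod d1 d2 : partial_injection d1 ->
  partial_injection d2 -> partial_injection (rel_prod d1 d2).
Proof.
by move=> [d1f d1i] [d2f d2i]; split;
  [exact: functional_prod d1f d2f | exact: functional_prod d1i d2i].
Qed.

Lemma linear_orientation_prodl k d1 d2 : linear_orientation k d1 ->
  partial_injection d2 -> linear_orientation k (rel_prod d1 d2).
Proof.
move=> [d1_inj [r d1r rk]] d2_inj; split; first exact: partial_injection_prod.
by exists (r \o fst) => [p q /andP[/d1r pq _]|p] /=.
Qed.

Lemma linear_orientation_prodr k d1 d2 : partial_injection d1 ->
  linear_orientation k d2 -> linear_orientation k (rel_prod d1 d2).
Proof.
move=> d1_inj [d2_inj [r d2r rk]]; split; first exact: partial_injection_prod.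
by exists (r \o snd) => [p q /andP[_ /d2r pq]|p] /=.
Qed.

End Product.

Section LinearForest.
Variable T : finType.
Implicit Types d e : rel T.

Lemma functional_connect d x y z :
  functional d -> d x y -> connect d x z -> x = z \/ connect d y z.
Proof.
move=> df xy /connectP[[_ ->|w p /andP[xw wp] ->]]; first by left.
right; rewrite /= (df _ _ _ xy xw).
by apply/connectP; exists p.
Qed.

Lemma connect_sym_closure d x y : partial_injection d ->
  connect (sym_closure d) x y -> connect d x y \/ connect d y x.
Proof.
move=> [df di] /connectP[p]; elim/last_ind: p y => [|p z IHp] y /=.
  by move=> _ ->; left.
rewrite rcons_path last_rcons => /andP[/IHp/(_ erefl)].
move: (last x p) => w xw wz ->.
case: xw (orP wz) => [xw|wx] [wz'|zw].
- by left; apply: connect_trans xw (connect1 wz').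
- rewrite -[connect d x w](connect_rev d w x) in xw.
  have [<-|] := functional_connect di zw xw; first by right; apply: connect1.
  by rewrite connect_rev; left.
- have [<-|] := functional_connect df wz' wx; first by left; apply: connect1.
  by right.
- by right; apply: connect_trans (connect1 zw) wx.
Qed.

Lemma connect_rank_eq d r x y : rank_function d r ->
  connect d x y -> r y <= r x -> x = y.
Proof.
move=> dr /connectP[p pth ->]; rewrite (rank_last dr pth) -{2}[r x]addn0.
by rewrite leq_add2l leqn0 => /nilP->.
Qed.

Lemma connect_of_rank_leq d r x y : partial_injection d -> rank_function d r ->
  connect (sym_closure d) x y -> r x <= r y -> connect d x y.
Proof.
move=> d_inj dr /(connect_sym_closure d_inj)[//|yx] rxy.
by rewrite (connect_rank_eq dr yx rxy).
Qed.

Lemma is_pathP e (C : {set T}) n :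
  reflect (exists s : seq T, [/\ size s = n.+1, uniq s, s =i C &
             {in s &, forall x y, e x y = ((index x s).+1 == index y s)
                                       || ((index y s).+1 == index x s)}])
          (is_path e C n).
Proof.
apply: (iffP existsP) => [[f /and3P[/injectiveP f_inj /eqP fC /forallP ef]]|].
  have index_f i : index (f i) (codom f) = i.
    by rewrite codomE index_map // index_enum_ord.
  exists (codom f); split.
  - by rewrite size_codom card_ord.
  - exact/injectiveP.
  - by move=> y; rewrite -fC; apply/codomP/imsetP=> [[i ->]|[i _ ->]]; exists i.
  - move=> _ _ /codomP[i ->] /codomP[j ->]; rewrite !index_f.
    exact/eqP/(forallP (ef i)).
case=> -[[]//|x0 s0]; set s := x0 :: s0 => -[sz_s s_uniq sC es].
have lt_s (i : 'I_n.+1) : i < size s by rewrite sz_s.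
exists [ffun i : 'I_n.+1 => nth x0 s i]; apply/and3P; split.
- apply/injectiveP=> i j; rewrite !ffunE => /eqP.
  by rewrite nth_uniq // => /eqP/val_inj.
- apply/eqP/setP=> y; rewrite -sC; apply/imsetP/idP=> [[i _ ->]|ys].
    by rewrite ffunE mem_nth.
  have lt_y : index y s < n.+1 by rewrite -sz_s index_mem.
  by exists (Ordinal lt_y); rewrite ?ffunE ?nth_index.
- apply/'forall_forallP=> i j; rewrite !ffunE es ?mem_nth //.
  by rewrite !index_uniq.
Qed.

(* At a vertex of maximal rank on a cycle both neighbours are predecessors. *)
Lemma sym_closure_forest d r :
  functional [rel x y | d y x] -> rank_function d r -> forest (sym_closure d).
Proof.
move=> di dr; apply/'forall_forallP=> n c; apply/implyP=> /andP[cyc_c c_uniq].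
rewrite ltnS -(size_tuple c); case: (tval c) cyc_c c_uniq => // x0 s.
move: (x0 :: s) (mem_head x0 s) => {n}c x0c cyc_c c_uniq.
case: (@arg_maxnP _ x0 (mem c) r x0c) => x xc x_max.
apply: (next_eq_prev_size c_uniq xc).
have pred_x y : y \in c -> sym_closure d x y -> d y x.
  by move=> /x_max le_yx /orP[/dr ry|//]; rewrite /= ry ltnn in le_yx.
apply: (di x); apply: pred_x; rewrite ?mem_next ?mem_prev ?next_cycle //.
by rewrite sym_closure_sym prev_cycle.
Qed.

Lemma rank_path_is_path d r x p (C : {set T}) :
  rank_function d r -> path d x p -> x :: p =i C ->
  is_path (sym_closure d) C (size p).
Proof.
move=> dr xp pC; set s := x :: p; have r_s := rank_path dr xp.
have s_uniq : uniq s by rewrite (@map_uniq _ _ r) // r_s iota_uniq.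
have rE y : y \in s -> r y = r x + index y s.
  move=> ys; have lt_y : index y s < (size p).+1 by rewrite index_mem.
  by rewrite -(nth_iota 0 (r x) lt_y) -r_s (nth_map x) // nth_index.
apply/is_pathP; exists s; split=> //.
have dE : {in s &, forall y z, d y z = ((index y s).+1 == index z s)}.
  move=> y z ys zs; apply/idP/eqP=> [/dr|yz].
    by rewrite (rE y) // (rE z) // -addnS => /addnI.
  have lt_y : index y s < size p by rewrite -ltnS yz index_mem.
  rewrite -(nth_index x ys) -(nth_index x zs) -yz /=.
  exact: (pathP x xp).
by move=> y z ys zs; rewrite /sym_closure !dE.
Qed.

(* The component is traversed by the directed path from its vertex of minimal
   rank to its vertex of maximal rank. *)
Lemma linear_orientation_component_path k d x : linear_orientation k d ->
  exists n : 'I_k.+1, is_path (sym_closure d) (component (sym_closure d) x) n.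
Proof.
move=> [d_inj [r dr rk]]; set e := sym_closure d.
have e_csym : connect_sym e by apply: sym_connect_sym (sym_closure_sym d).
case: (@arg_minnP _ x (connect e x) r (connect0 _ _)) => a xa a_min.
case: (@arg_maxnP _ x (connect e x) r (connect0 _ _)) => b xb b_max.
have conn_e y z : connect e x y -> connect e x z -> connect e y z.
  by move=> xy xz; rewrite -(same_connect e_csym xy).
have from_a y : connect e x y -> connect d a y.
  move=> xy; apply: (connect_of_rank_leq d_inj dr _ (a_min y xy)).
  exact: conn_e _ _ xa xy.
have to_b y : connect e x y -> connect d y b.
  move=> xy; apply: (connect_of_rank_leq d_inj dr _ (b_max y xy)).
  exact: conn_e _ _ xy xb.
have /connectP[p ap b_last] := from_a b xb.
have lt_p : size p < k.+1.
  by rewrite ltnS (leq_trans _ (rk b)) // b_last (rank_last dr ap) leq_addl.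
exists (Ordinal lt_p); apply: (rank_path_is_path dr ap) => y.
rewrite [RHS]inE; apply/idP/idP=> [/(path_connect ap) ay|xy].
  apply: connect_trans xa _; apply: connect_sub ay => u v uv.
  by apply: connect1; rewrite /e /sym_closure uv.
have /connectP[q aq y_last] := from_a y xy.
have /connectP[q' yq' b_last'] := to_b y xy.
have aqq' : path d a (q ++ q') by rewrite cat_path aq -y_last.
have -> : p = q ++ q'.
  apply: (functional_path_inj d_inj.1 ap aqq'); apply: (@addnI (r a)).
  rewrite -(rank_last dr ap) -(rank_last dr aqq') last_cat.
  by rewrite -y_last -b_last -b_last'.
by rewrite -cat_cons mem_cat y_last mem_last.
Qed.

Lemma linear_forest_rank k e : symmetric e -> linear_forest k e ->
  exists r : T -> nat,
    [/\ forall x, r x <= k,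
        forall x y, connect e x y -> r x = r y -> x = y
      & forall x y, e x y -> r y = (r x).+1 \/ r x = (r y).+1].
Proof.
move=> e_sym /andP[_ /forallP paths].
have e_csym : connect_sym e by apply: sym_connect_sym.
have /fin_all_exists[walk walkP] x : exists s : seq T,
    [/\ size s <= k.+1, s =i component e x
      & {in s &, forall y z, e y z ->
          index z s = (index y s).+1 \/ index y s = (index z s).+1}].
  have /existsP[n /is_pathP[s [sz_s _ s_comp es]]] := paths x.
  exists s; split=> [|//|y z ys zs]; first by rewrite sz_s ltn_ord.
  by rewrite es // => /orP[]/eqP->; [left|right].
have mem_walk x : x \in walk (root e x).
  by have [_ -> _] := walkP (root e x); rewrite inE e_csym connect_root.
have eq_root x y : connect e x y -> root e x = root e y.
  by rewrite -root_connect // => /eqP.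
exists (fun x => index x (walk (root e x))); split=> [x|x y xy|x y xy].
- have [sz _ _] := walkP (root e x).
  by rewrite -ltnS (leq_trans _ sz) // index_mem.
- have := mem_walk x; have := mem_walk y; rewrite (eq_root _ _ xy).
  by move: (walk _) => s ys xs eq_xy; rewrite -(nth_index x xs) eq_xy nth_index.
- have := mem_walk x; have := mem_walk y.
  rewrite (eq_root _ _ (connect1 xy)) => ys xs.
  by have [_ _ step] := walkP (root e y); apply: step.
Qed.

Lemma eq_linear_forest k e e' :
  e =2 e' -> linear_forest k e = linear_forest k e'.
Proof.
move=> ee'; congr (_ && _).
  by apply: eq_forallb => n; apply: eq_forallb => c; rewrite (eq_cycle ee').
apply: eq_forallb => x; apply: eq_existsb => n.
have -> : component e x = component e' x.
  by apply/setP=> y; rewrite !inE (eq_connect ee').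
apply: eq_existsb => f; congr [&& _, _ & _].
by apply: eq_forallb => i; apply: eq_forallb => j; rewrite ee'.
Qed.

Lemma linear_forestP k e : symmetric e ->
  reflect (exists2 d, linear_orientation k d & e =2 sym_closure d)
          (linear_forest k e).
Proof.
move=> e_sym; apply: (iffP idP) => [|[d d_or e_d]]; last first.
  rewrite (eq_linear_forest _ e_d); apply/andP; split.
    by have [[_ di] [r dr _]] := d_or; apply: sym_closure_forest dr.
  by apply/forallP=> x; apply/existsP/linear_orientation_component_path.
case/linear_forest_rank=> // r [rk r_inj r_step].
exists (fun x y => e x y && (r y == (r x).+1)) => [|x y]; last first.
  rewrite /sym_closure [e y x]e_sym -andb_orr andbC.
  by case: (boolP (e x y)) => [/r_step|]; rewrite ?andbF // => -[]->;
    rewrite eqxx ?orbT.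
split; last by exists r => // x y /andP[_ /eqP].
split=> [x y z /andP[xy /eqP ry] /andP[xz /eqP rz]
        |z x y /andP[xz /eqP rz] /andP[yz /eqP rz']].
- apply: r_inj; last by rewrite ry rz.
  by apply: (@connect_trans _ _ x); apply: connect1; rewrite // e_sym.
- apply: r_inj; last by apply: succn_inj; rewrite -rz.
  by apply: (@connect_trans _ _ z); apply: connect1; rewrite // e_sym.
Qed.

Lemma sub_linear_forest k e e' : symmetric e -> symmetric e' ->
  subrel e' e -> linear_forest k e -> linear_forest k e'.
Proof.
move=> e_sym e'_sym sub /(linear_forestP k e_sym)[d d_or e_d].
apply/linear_forestP => //; exists (fun x y => d x y && e' x y) => [|x y].
  by apply: sub_linear_orientation d_or => x y /andP[].
rewrite /sym_closure [e' y x]e'_sym -andb_orl -[d x y || _]e_d andbC.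
by case: (boolP (e' x y)) => // /sub ->.
Qed.

Lemma card_sym_closure_neighbors d x :
  partial_injection d -> #|[set y | sym_closure d x y]| <= 2.
Proof.
move=> [df di]; have -> : [set y | sym_closure d x y] =
    [set y | d x y] :|: [set y | d y x] by apply/setP=> y; rewrite !inE.
apply: leq_trans (leq_card_setU _ _) _; rewrite -[2]/(1 + 1).
apply: leq_add; apply/card_le1_eqP=> y z; rewrite !inE => xy xz.
- exact: df xz xy.
- exact: di xz xy.
Qed.

Lemma mem_unordered_pairs d x y :
  ([set x; y] \in [set [set p.1; p.2] | p : T * T & d p.1 p.2]) =
  sym_closure d x y.
Proof.
apply/imsetP/orP=> [[[u v] uv /eqP]|[xy|yx]].
- rewrite inE /= in uv; rewrite eq_set2.
  by case/orP=> /andP[/eqP-> /eqP->]; [left|right].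
- by exists (x, y); rewrite ?inE.
- by exists (y, x); rewrite ?inE //= setUC.
Qed.

End LinearForest.

Section Arboricity.
Implicit Types G : sgraph.

Lemma mem_edges G (x y : G) : ([set x; y] \in edges G) = adj x y.
Proof. by rewrite mem_unordered_pairs /sym_closure [adj y x]adj_sym orbb. Qed.

Lemma edge_rel_sym G (F : {set {set G}}) : symmetric (edge_rel F).
Proof. by move=> x y; rewrite /edge_rel setUC. Qed.

Lemma linear_arboricity_leq_forest_cover k G (I : finType)
    (F : I -> {set {set G}}) :
    0 < k -> edges G \subset \bigcup_i F i ->
    (forall i, linear_forest k (edge_rel (F i))) ->
  linear_arboricity k G <= #|I|.
Proof.
move=> k_gt0 /refine_cover_partition[P [partP card_P P_F]] F_forest.
have [_ min_la] := linear_arboricityP G k_gt0.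
apply: leq_trans (min_la P _) card_P; apply/andP; split=> //.
apply/'forall_implyP=> B /P_F[i /subsetP BF].
apply: sub_linear_forest (F_forest i) => [||x y]; try exact: edge_rel_sym.
exact: BF.
Qed.

(* The relations may overlap and need not be contained in the adjacency. *)
Definition linear_cover k G (I : finType) (d : I -> rel G) : Prop :=
  (forall i, linear_orientation k (d i)) /\
  (forall x y, adj x y -> exists i, sym_closure (d i) x y).

Lemma linear_arboricity_leq_linear_cover k G (I : finType) (d : I -> rel G) :
  0 < k -> linear_cover k d -> linear_arboricity k G <= #|I|.
Proof.
move=> k_gt0 [d_or d_cov].
pose F i : {set {set G}} := [set [set p.1; p.2] | p : G * G & d i p.1 p.2].
apply: (@linear_arboricity_leq_forest_cover k G I F) => // [|i].
  apply/subsetP=> _ /imsetP[[x y] + ->]; rewrite inE /= => /d_cov[i d_xy].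
  by apply/bigcupP; exists i; rewrite // mem_unordered_pairs.
apply/linear_forestP; first exact: edge_rel_sym.
by exists (d i) => // x y; apply: mem_unordered_pairs.
Qed.

Lemma linear_cover_arboricity k G : 0 < k ->
  exists d : 'I_(linear_arboricity k G) -> rel G, linear_cover k d.
Proof.
move=> k_gt0.
have [[P /andP[partP P_forest] <-] _] := linear_arboricityP G k_gt0.
move/'forall_implyP in P_forest.
have /fin_all_exists[d d_P] (i : 'I_#|P|) : exists d : rel G,
    linear_orientation k d /\ edge_rel (enum_val i) =2 sym_closure d.
  have /linear_forestP[|d d_or eE] := P_forest _ (enum_valP i).
    exact: edge_rel_sym.
  by exists d.
exists d; split=> [i|x y]; first by have [] := d_P i.
rewrite -mem_edges -(cover_partition partP) => /bigcupP[F FP xyF].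
exists (enum_rank_in FP F).
by have [_ <-] := d_P (enum_rank_in FP F); rewrite /edge_rel enum_rankK_in.
Qed.

Lemma max_degree_leq_linear_cover k G (I : finType) (d : I -> rel G) :
  linear_cover k d -> max_degree G <= 2 * #|I|.
Proof.
move=> [d_or d_cov]; apply/bigmax_leqP=> x _.
have /subset_leq_card/leq_trans-> // : [set y | adj x y] \subset
    \bigcup_i [set y | sym_closure (d i) x y].
  apply/subsetP=> y; rewrite inE => /d_cov[i xy].
  by apply/bigcupP; exists i; rewrite // inE.
rewrite mulnC -sum_nat_const.
apply: (big_ind2 (fun (A : {set G}) m => #|A| <= m)) => [|A m B n Am Bn|i _].
- by rewrite cards0.
- exact: leq_trans (leq_card_setU _ _) (leq_add Am Bn).
- by apply: card_sym_closure_neighbors; have [] := d_or i.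
Qed.

Lemma max_degree_leq_linear_arboricity k G :
  0 < k -> max_degree G <= 2 * linear_arboricity k G.
Proof.
move=> /(linear_cover_arboricity G)[d /max_degree_leq_linear_cover].
by rewrite card_ord.
Qed.

End Arboricity.

Definition degree (G : sgraph) (x : G) : nat := #|[set y | adj x y]|.

Section StrongProduct.
Variables G H : sgraph.

Lemma degree_strong_product (x : G) (y : H) :
  degree ((x, y) : strong_product G H) =
    degree x * degree y + degree x + degree y.
Proof.
have closed_nbhd : setX (x |: [set x' | adj x x']) (y |: [set y' | adj y y'])
    = (x, y) |: [set q : G * H | adj ((x, y) : strong_product G H) q].
  apply/setP=> -[x' y']; rewrite !inE /= /strong_adj /= xpair_eqE.
  rewrite [x == x']eq_sym [y == y']eq_sym.
  by case: (x' == x); case: (y' == y); case: (adj x x'); case: (adj y y').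
have := congr1 (fun A : {set _} => #|A|) closed_nbhd.
rewrite cardsX !cardsU1 !inE !adj_irr !add1n mulSn mulnS addSn => -[card_nbhd].
apply: etrans (esym card_nbhd) _.
by rewrite addnC [degree x * degree y + _]addnC.
Qed.

Lemma max_degree_strong_product : 0 < #|G| -> 0 < #|H| ->
  max_degree (strong_product G H) =
    max_degree G * max_degree H + max_degree G + max_degree H.
Proof.
move=> G_gt0 H_gt0; apply/eqP; rewrite eqn_leq; apply/andP; split.
  apply/bigmax_leqP=> -[x y] _; rewrite -/(degree _) degree_strong_product.
  by rewrite !leq_add ?leq_mul //; exact: leq_bigmax.
have [x ->] : {x : G | max_degree G = degree x} by apply: eq_bigmax.
have [y ->] : {y : H | max_degree H = degree y} by apply: eq_bigmax.
rewrite -degree_strong_product.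
exact: (leq_bigmax ((x, y) : strong_product G H)).
Qed.

Definition strong_product_cover (I J : Type) (d1 : I -> rel G) (d2 : J -> rel H)
    (i : I + J + bool * I * J) : rel (strong_product G H) :=
  match i with
  | inl (inl i) => rel_prod (d1 i) eq_op
  | inl (inr j) => rel_prod eq_op (d2 j)
  | inr (true, i, j) => rel_prod (d1 i) (d2 j)
  | inr (false, i, j) => rel_prod (d1 i) [rel x y | d2 j y x]
  end.

Variables k l : nat.

Lemma linear_cover_strong_product (I J : finType) (d1 : I -> rel G)
    (d2 : J -> rel H) :
  linear_cover k d1 -> linear_cover l d2 ->
  linear_cover (maxn k l) (strong_product_cover d1 d2).
Proof.
move=> [d1_or d1_cov] [d2_or d2_cov].
have {}d1_or i : linear_orientation (maxn k l) (d1 i).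
  exact: linear_orientation_leq (leq_maxl k l) (d1_or i).
have {}d2_or j : linear_orientation (maxn k l) (d2 j).
  exact: linear_orientation_leq (leq_maxr k l) (d2_or j).
split=> [[[i|j]|[[[] i] j]]|[x1 x2] [y1 y2]] /=.
- exact/linear_orientation_prodl/partial_injection_eq_op.
- exact/linear_orientation_prodr/d2_or/partial_injection_eq_op.
- by apply: linear_orientation_prodl => //; have [] := d2_or j.
- apply: linear_orientation_prodl => //; apply: partial_injection_converse.
  by have [] := d2_or j.
rewrite /strong_adj /= => /or3P[] /andP[].
- move=> /d1_cov[i xy] /eqP->; exists (inl (inl i)).
  by rewrite /sym_closure /= /rel_prod /= eqxx !andbT.
- move=> /eqP-> /d2_cov[j xy]; exists (inl (inr j)).
  by rewrite /sym_closure /= /rel_prod /= eqxx.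
move=> /d1_cov[i xy1] /d2_cov[j xy2].
have [s] : exists s, sym_closure (strong_product_cover d1 d2 (inr (s, i, j)))
    (x1, x2) (y1, y2); last by exists (inr (s, i, j)).
case/orP: xy1 xy2 => xy1 /orP[]xy2;
  [exists true|exists false|exists false|exists true];
  by rewrite /sym_closure /= /rel_prod /= xy1 xy2 ?orbT.
Qed.

Hypotheses (k_gt0 : 0 < k) (l_gt0 : 0 < l).

Lemma strong_product_arboricity_leq :
  linear_arboricity (maxn k l) (strong_product G H)
    <= linear_arboricity k G + linear_arboricity l H
       + 2 * linear_arboricity k G * linear_arboricity l H.
Proof.
have [d1 d1_cov] := linear_cover_arboricity G k_gt0.
have [d2 d2_cov] := linear_cover_arboricity H l_gt0.
have kl_gt0 : 0 < maxn k l by rewrite leq_max k_gt0.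
have := linear_arboricity_leq_linear_cover kl_gt0
          (linear_cover_strong_product d1_cov d2_cov).
by rewrite !card_sum !card_prod card_bool !card_ord.
Qed.

Lemma strong_product_arboricity_geq : 0 < #|G| -> 0 < #|H| ->
  uphalf (max_degree G * max_degree H + max_degree G + max_degree H)
    <= linear_arboricity (maxn k l) (strong_product G H).
Proof.
move=> G_gt0 H_gt0; rewrite -max_degree_strong_product // leq_uphalf_double.
by rewrite -mul2n max_degree_leq_linear_arboricity // leq_max k_gt0.
Qed.

Lemma strong_product_arboricity_tight : 0 < #|G| -> 0 < #|H| ->
    max_degree G = 2 * linear_arboricity k G ->
    max_degree H = 2 * linear_arboricity l H ->
  uphalf (max_degree G * max_degree H + max_degree G + max_degree H)
    = linear_arboricity (maxn k l) (strong_product G H)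
  /\ linear_arboricity (maxn k l) (strong_product G H)
    = linear_arboricity k G + linear_arboricity l H
      + 2 * linear_arboricity k G * linear_arboricity l H.
Proof.
move=> G_gt0 H_gt0 degG degH.
have lower := strong_product_arboricity_geq G_gt0 H_gt0.
have upper := strong_product_arboricity_leq.
suff bounds_eq :
    uphalf (max_degree G * max_degree H + max_degree G + max_degree H) =
    linear_arboricity k G + linear_arboricity l H
    + 2 * linear_arboricity k G * linear_arboricity l H.
  by split; apply: anti_leq; rewrite ?lower ?upper ?bounds_eq // -bounds_eq.
rewrite degG degH -[RHS]uphalf_double -[in RHS]mul2n ![in RHS]mulnDr.
by rewrite -addnA addnC [2 * _ * (2 * _)]mulnCA.
Qed.

End StrongProduct.

Section PathGraph.
Variable n : nat.

Definition ord_succ_rel : rel 'I_n := fun i j => i.+1 == j.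

Fact path_graph_irr : irreflexive (sym_closure ord_succ_rel).
Proof. by move=> i; rewrite /sym_closure /ord_succ_rel orbb gtn_eqF. Qed.

Definition path_graph : sgraph :=
  SGraph (sym_closure_sym ord_succ_rel) path_graph_irr.

Lemma path_graph_arboricity_leq1 k :
  0 < k -> n <= k.+1 -> linear_arboricity k path_graph <= 1.
Proof.
move=> k_gt0 le_nk; rewrite -[1]card_unit.
pose d (_ : unit) := ord_succ_rel.
apply: (@linear_arboricity_leq_linear_cover k path_graph unit d) => //.
split=> [[]|x y xy]; last by exists tt.
split; last first.
  exists val => [i j /eqP/esym //|i]; rewrite -ltnS.
  exact: leq_trans (ltn_ord i) le_nk.
split=> x y z; rewrite /ord_succ_rel /= => /eqP xy /eqP xz; apply: val_inj.
- by rewrite /= -xy.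
- by apply: succn_inj; rewrite xy.
Qed.

Lemma path_graph_max_degree_geq2 : 2 < n -> 2 <= max_degree path_graph.
Proof.
move=> n_gt2; have n_gt1 := ltnW n_gt2; have n_gt0 := ltnW n_gt1.
pose v1 : path_graph := Ordinal n_gt1.
apply: leq_trans (leq_bigmax v1).
have <- : #|[set Ordinal n_gt0; Ordinal n_gt2]| = 2 by rewrite cards2.
by apply/subset_leq_card/subsetP=> i; rewrite !inE => /orP[]/eqP->.
Qed.

Lemma path_graph_max_degree_arboricity k : 2 < n -> n <= k.+1 ->
  max_degree path_graph = 2 * linear_arboricity k path_graph.
Proof.
move=> n_gt2 le_nk.
have k_gt0 : 0 < k by rewrite -ltnS (leq_trans (ltnW n_gt2)).
have la_le := path_graph_arboricity_leq1 k_gt0 le_nk.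
apply/eqP; rewrite eqn_leq max_degree_leq_linear_arboricity //=.
apply: leq_trans (path_graph_max_degree_geq2 n_gt2).
exact: leq_mul (leqnn 2) la_le.
Qed.

Lemma path_graph_edges_neq0 : 1 < n -> edges path_graph != set0.
Proof.
move=> n_gt1; have n_gt0 := ltnW n_gt1; apply/set0Pn.
by exists [set Ordinal n_gt0; Ordinal n_gt1 : path_graph]; rewrite mem_edges.
Qed.

End PathGraph.

Theorem theorem2p11 :
  (forall (G H : sgraph) (k l : nat),
     0 < #|G| -> 0 < #|H| -> 0 < k -> 0 < l ->
     uphalf (max_degree G * max_degree H + max_degree G + max_degree H)
       <= linear_arboricity (maxn k l) (strong_product G H)
       <= linear_arboricity k G + linear_arboricity l H
          + 2 * linear_arboricity k G * linear_arboricity l H)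
  /\ (exists (G H : sgraph) (k l : nat),
        [/\ edges G != set0, edges H != set0, 0 < k, 0 < l &
            uphalf (max_degree G * max_degree H + max_degree G + max_degree H)
              = linear_arboricity (maxn k l) (strong_product G H)])
  /\ (exists (G H : sgraph) (k l : nat),
        [/\ edges G != set0, edges H != set0, 0 < k, 0 < l &
            linear_arboricity (maxn k l) (strong_product G H)
              = linear_arboricity k G + linear_arboricity l H
                + 2 * linear_arboricity k G * linear_arboricity l H]).
Proof.
split=> [G H k l G_gt0 H_gt0 k_gt0 l_gt0|].
  by rewrite strong_product_arboricity_geq // strong_product_arboricity_leq.
pose P3 := path_graph 3; have P3_gt0 : 0 < #|P3| by rewrite card_ord.
have P3_edges : edges P3 != set0 by exact: path_graph_edges_neq0.
have P3_deg : max_degree P3 = 2 * linear_arboricity 2 P3.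
  exact: path_graph_max_degree_arboricity.
have [lower upper] := @strong_product_arboricity_tight
  P3 P3 2 2 isT isT P3_gt0 P3_gt0 P3_deg P3_deg.
by split; exists P3, P3, 2, 2.
Qed.
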